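(* Let $G$ be a finite non-cyclic group, and let $h,k\in G$ with $\langle h\rangle \subseteq \langle k\rangle$. Then $N_h \leq N_k$.
   Context: For a group $G$, the power graph $\mathscr{P}(G)$ is the simple graph with vertex set $G$ in which two distinct vertices $a,b$ are adjacent if and only if $\langle a\rangle \subseteq \langle b\rangle$ or $\langle b\rangle \subseteq \langle a\rangle$. For $a \in G$, $N(a)$ denotes the set of neighbors of $a$ in $\mathscr{P}(G)$ (so $a\notin N(a)$), $\widetilde{N(a)} = \{b \in N(a) \mid N(a)\setminus\{b\} = N(b)\setminus\{a\}\}$ is the set of closed twins of $a$, and $N_a = |\widetilde{N(a)}| + 1$. *)

(* Defs.v *)
From mathcomp Require Import all_boot all_fingroup all_solvable.

Set Implicit Arguments.
Unset Strict Implicit.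
Unset Printing Implicit Defensive.

Import GroupScope.

Definition power_adj (gT : finGroupType) : rel gT :=
  fun a b => (a != b) && ((<[a]> \subset <[b]>) || (<[b]> \subset <[a]>)).

Definition nbrs (gT : finGroupType) (G : {set gT}) (a : gT) : {set gT} :=
  [set b in G | power_adj a b].

Definition closed_twins (gT : finGroupType) (G : {set gT}) (a : gT) :
    {set gT} :=
  [set b in nbrs G a | nbrs G a :\ b == nbrs G b :\ a].

Definition twin_number (gT : finGroupType) (G : {set gT}) (a : gT) : nat :=
  (#|closed_twins G a| + 1)%N.

(* Main.v *)
Require Import Defs.
From mathcomp Require Import all_boot all_fingroup all_solvable.

Set Implicit Arguments.
Unset Strict Implicit.
Unset Printing Implicit Defensive.

Import GroupScope.

(** Together with [a], the closed twins of [a] form the class [twin_class G a]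
    of the elements with the same closed neighbourhood as [a].  Its members are
    pairwise adjacent, so they all lie in [<[y]>] for a member [y] of maximal
    order.  The key point is that if two twins [a], [b] satisfy
    [<[a]> < <[b]>], then every cyclic subgroup above [<[b]>] has prime power
    order; the case [a = 1] is where non-cyclicity of [G] is used.
    Now [k] is adjacent to [h], hence to [y].  If [k] lies in [<[y]>] then [k]
    is a twin of [h].  Otherwise [<[y]> < <[k]>]: either all twins of [h]
    generate [<[y]>] and one compares Euler totients, or [k] has order [p ^ j],
    [y] has order [p ^ i] with [i < j], and [p ^ i <= totient (p ^ j)]. *)

(** Strong induction on [n]: for [p := pdiv n], multiplicativity splits both totients into [p]-parts
    and [p^']-parts. The [p]-parts are compared by the prime power formula, the [p^']-parts by
    induction. *)
Lemma leq_totient_dvd d n : 0 < n -> d %| n -> totient d <= totient n.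
Proof.
elim/ltn_ind: n d => n IHn d n_gt0 d_dv_n.
have d_gt0 := dvdn_gt0 n_gt0 d_dv_n.
have [n_le1 | n_gt1] := leqP n 1.
  have n1 : n = 1%N by apply/eqP; rewrite eqn_leq n_le1.
  by move: d_dv_n; rewrite n1 dvdn1 => /eqP->.
have p_pr := pdiv_prime n_gt1; set p := pdiv n in p_pr.
rewrite -(partnC p d_gt0) -(partnC p n_gt0) !totient_coprime ?coprime_partC //.
apply: leq_mul; last first.
  apply: IHn; rewrite ?part_gt0 ?partn_dvd //.
  rewrite -[ltnRHS](partnC p n_gt0) ltn_Pmull ?part_gt0 //.
  by rewrite p_part_gt1 mem_primes p_pr n_gt0 pdiv_dvd.
have le_log : logn p d <= logn p n by apply: dvdn_leq_log.
(* The exponent 0 is split off because [totient_pfactor] needs a positive one. *)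
rewrite !p_part; case: (logn p d) le_log => [|i] le_log.
  by rewrite expn0 totient_gt0 expn_gt0 prime_gt0.
rewrite !totient_pfactor ?(leq_trans _ le_log) // leq_mul2l.
by apply/orP; right; rewrite leq_exp2l ?prime_gt1 // -!subn1 leq_sub2r.
Qed.

Lemma leq_expn_totient p i j : prime p -> i < j -> p ^ i <= totient (p ^ j).
Proof.
move=> p_pr lt_ij; rewrite totient_pfactor ?(leq_ltn_trans _ lt_ij) //.
apply: (@leq_trans (p ^ j.-1)).
  by rewrite leq_exp2l ?prime_gt1 // -ltnS (ltn_predK lt_ij).
by rewrite leq_pmull // -ltnS (ltn_predK (prime_gt1 p_pr)) prime_gt1.
Qed.

Section CycleComparability.

Variable gT : finGroupType.
Implicit Types (a b c x y : gT) (G : {group gT}).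

Definition cycle_comp a b := (a \in <[b]>) || (b \in <[a]>).

Lemma cycle_comp_refl a : cycle_comp a a.
Proof. by rewrite /cycle_comp cycle_id. Qed.

Lemma cycle_compC a b : cycle_comp a b = cycle_comp b a.
Proof. exact: orbC. Qed.

Lemma mem_cycle_trans b a c : a \in <[b]> -> b \in <[c]> -> a \in <[c]>.
Proof. by rewrite -!cycle_subG; apply: subset_trans. Qed.

Lemma constt_mem_cycle x y :
  (forall p : nat, x.`_p \in <[y]>) -> x \in <[y]>.
Proof. by move=> xy; rewrite -[x]prod_constt group_prod. Qed.

Lemma p_p'_elt1 (p : nat) x : p.-elt x -> p^'.-elt x -> x = 1.
Proof. by move=> px /constt1P; rewrite constt_p_elt. Qed.

Lemma cycle_comp_p_p'_elt (p : nat) x y :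
  p.-elt x -> p^'.-elt y -> cycle_comp x y -> x = 1 \/ y = 1.
Proof.
move=> px p'y /orP[xy | yx]; [left | right]; apply: (@p_p'_elt1 p) => //.
- exact: mem_p_elt p'y xy.
- exact: mem_p_elt px yx.
Qed.

(** Inside the cyclic group [<[z]>], inclusion of subgroups is divisibility of orders, and powers of
    [p] form a chain under divisibility. *)
Lemma p_elt_cycle_comp (p : nat) x y z :
  p.-elt z -> x \in <[z]> -> y \in <[z]> -> cycle_comp x y.
Proof.
move=> pz xz yz; have px := mem_p_elt pz xz; have py := mem_p_elt pz yz.
have sub_dvd u v : u \in <[z]> -> v \in <[z]> -> (u \in <[v]>) = (#[u] %| #[v]).
  by move=> uz vz; rewrite -cycle_subG -(cardSg_cyclic (cycle_cyclic z)) ?cycle_subG.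
rewrite /cycle_comp (sub_dvd x y) // (sub_dvd y x) //.
move: (p_natP px) (p_natP py) => [i ->] [j ->].
by case: (leqP i j) => [le_ij | /ltnW le_ji]; apply/orP; [left | right];
  apply: dvdn_exp2l.
Qed.

Definition closed_nbrs (G : {set gT}) a := [set b in G | cycle_comp a b].

Definition twin_class (G : {set gT}) a :=
  [set b in G | closed_nbrs G a == closed_nbrs G b].

Lemma nbrsE (G : {set gT}) a : nbrs G a = closed_nbrs G a :\ a.
Proof.
apply/setP=> b.
by rewrite !inE /power_adj /cycle_comp !cycle_subG eq_sym andbCA.
Qed.

Lemma closed_twinsE (G : {set gT}) a :
  a \in G -> closed_twins G a = twin_class G a :\ a.
Proof.
move=> aG; apply/setP=> b; rewrite inE !nbrsE !inE.
case: (b =P a) => //= _; case bG: (b \in G) => //=.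
apply/andP/eqP=> [[ab /eqP/setP eq_ab] | eq_ab].
  (* The hypothesis is silent only at [u = a] and [u = b], and there adjacency of [a] and [b]
     decides. *)
  apply/setP=> u; have := eq_ab u; rewrite !inE.
  case: (u =P a) => [-> _ | _]; first by rewrite aG cycle_comp_refl cycle_compC.
  by case: (u =P b) => [-> _ | //]; rewrite bG ab cycle_comp_refl.
split; last by rewrite eq_ab !setDDl setUC.
by have := cycle_comp_refl b; move/setP/(_ b): eq_ab; rewrite !inE bG /= => ->.
Qed.

Lemma twin_numberE (G : {set gT}) a :
  a \in G -> twin_number G a = #|twin_class G a|.
Proof.
move=> aG; rewrite /twin_number closed_twinsE // addnC.
by rewrite [RHS](cardsD1 a) inE aG eqxx.
Qed.

Lemma eq_closed_nbrs_comp (G : {set gT}) a b u :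
  closed_nbrs G a = closed_nbrs G b -> u \in G ->
  cycle_comp a u = cycle_comp b u.
Proof. by move/setP/(_ u); rewrite !inE => + uG; rewrite uG. Qed.

Lemma eq_cycle_closed_nbrs (G : {set gT}) a b :
  <[a]> = <[b]> -> closed_nbrs G a = closed_nbrs G b.
Proof.
move=> eq_ab; apply/setP=> u; rewrite !inE /cycle_comp -eq_ab.
by rewrite -!cycle_subG eq_ab.
Qed.

Lemma leq_totient_twin_class G a :
  a \in G -> totient #[a] <= #|twin_class G a|.
Proof.
move=> aG; rewrite totient_gen; apply/subset_leq_card/subsetP=> b.
rewrite !inE => /eqP eq_ab.
by rewrite (eq_cycle_closed_nbrs G eq_ab) eqxx -cycle_subG -eq_ab cycle_subG aG.
Qed.

Lemma dominating_p_elt G b (q : nat) :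
    ~~ cyclic G -> b \in G -> (forall u, u \in G -> cycle_comp b u) ->
  b.`_q != 1 -> q.-elt b.
Proof.
move=> ncycG bG dom_b bq_neq1; apply: contraR ncycG => not_qb.
apply/cyclicP; exists b; apply/eqP; rewrite eqEsubset cycle_subG bG andbT.
apply/subsetP=> x xG; apply: constt_mem_cycle => s.
have /orP[bxs|//] : cycle_comp b x.`_s by rewrite dom_b ?groupX.
have sb := mem_p_elt (p_elt_constt s x) bxs.
have [eq_sq | neq_sq] := eqVneq s q; first by rewrite -eq_sq sb in not_qb.
case/eqP: bq_neq1; apply/constt1P; apply: sub_in_pnat sb => r _.
by rewrite !inE => /eqP->.
Qed.

Lemma twins_above_p_elt G a b c :
    ~~ cyclic G -> a \in G -> c \in G ->
    closed_nbrs G a = closed_nbrs G b ->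
    a \in <[b]> -> b \notin <[a]> -> b \in <[c]> ->
  exists2 q : nat, prime q & q.-elt c.
Proof.
move=> ncycG aG cG eq_ab ab nba bc.
have bG : b \in G by apply: subsetP bc; rewrite cycle_subG.
have comp_ab u (uG : u \in G) := eq_closed_nbrs_comp eq_ab uG.
have [q nbqa] : exists q : nat, b.`_q \notin <[a]>.
  have [/forallP all_b | ] :=
    boolP [forall q : 'I_#[b].+1, b.`_q \in <[a]>].
    case/negP: nba; rewrite -[b]prod_constt big_mkord.
    by apply: group_prod => q _; apply: all_b.
  by rewrite negb_forall => /existsP[q nq]; exists (q : nat).
have bq_neq1 : b.`_q != 1 by apply: contraNneq nbqa => ->.
(* Constituents at non-prime indices are trivial. *)
have q_pr : prime q.
  apply: contraR bq_neq1 => not_q_pr; apply/eqP/constt1P.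
  apply/pnatP=> // r r_pr _; rewrite !inE.
  by apply: contraNneq not_q_pr => <-.
exists q => //.
have wG : c.`_q^' \in G by rewrite groupX.
(* Write [w] for the [q^']-part of [c]. If [a != 1], then [a] is a [q]-element and is the [q]-part
   of [a * w]. Testing the twins on [a * w] forces [w] into [<[b]>], so [w] is comparable to [a], of
   coprime order, hence trivial. *)
suff w1 : c.`_q^' = 1.
  by have /constt1P := w1; apply: sub_in_pnat => r _; rewrite inE /= negbK.
have q'w := p_elt_constt q^' c.
have [a1 | a_neq1] := eqVneq a 1.
  have dom_b u : u \in G -> cycle_comp b u.
    by move=> uG; rewrite -comp_ab // a1 /cycle_comp group1.
  have qb := dominating_p_elt ncycG bG dom_b bq_neq1.
  have [b1 | //] := cycle_comp_p_p'_elt qb q'w (dom_b _ wG).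
  by rewrite b1 group1 in nba.
have abq : a \in <[b.`_q]>.
  have : cycle_comp a b.`_q.
    by rewrite comp_ab ?groupX // /cycle_comp cycle_constt orbT.
  by case/orP=> //; rewrite (negPf nbqa).
have qa : q.-elt a := mem_p_elt (p_elt_constt q b) abq.
have caw : commute a c.`_q^'.
  have ac := mem_cycle_trans ab bc.
  exact: (centsP (cycle_abelian c)) ac _ (cycle_constt _ _).
have q'w1 : (c.`_q^').`_q = 1 by apply/constt1P.
have awq : (a * c.`_q^').`_q = a.
  by rewrite consttM // q'w1 mulg1 constt_p_elt.
have awq' : (a * c.`_q^').`_q^' = c.`_q^'.
  rewrite consttM // (constt_p_elt q'w).
  suff -> : a.`_q^' = 1 by rewrite mul1g.
  by apply/constt1P; rewrite /p_elt pnatNK.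
have aw_b : a * c.`_q^' \in <[b]>.
  have : cycle_comp b (a * c.`_q^').
    rewrite -comp_ab ?groupM // /cycle_comp.
    by rewrite -[X in X \in _]awq cycle_constt.
  (* If [b] were a power of [a * w], its [q]-part would be a power of [a], against the choice of
     [q]. *)
  case/orP=> // /cycleP[n b_aw]; case/negP: nbqa.
  by rewrite b_aw consttX awq mem_cycle.
have wb : c.`_q^' \in <[b]>.
  by rewrite -awq'; apply: mem_cycle_trans aw_b; apply: cycle_constt.
have : cycle_comp a c.`_q^' by rewrite comp_ab // /cycle_comp wb orbT.
case/(cycle_comp_p_p'_elt qa q'w) => // a1.
by rewrite a1 eqxx in a_neq1.
Qed.

End CycleComparability.

Theorem lemma3p13 (gT : finGroupType) (G : {group gT}) (h k : gT)
    (ncycG : ~~ cyclic G) (hG : h \in G) (kG : k \in G)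
    (sub_hk : <[h]> \subset <[k]>) :
  (twin_number G h <= twin_number G k)%N.
Proof.
rewrite !twin_numberE //; rewrite cycle_subG in sub_hk.
have hT : h \in twin_class G h by rewrite inE hG eqxx.
pose y := [arg max_(y > h in twin_class G h) #[y]].
have [yT max_y] : y \in twin_class G h /\
    forall t, t \in twin_class G h -> #[t] <= #[y].
  by rewrite /y; case: arg_maxnP.
have [yG eq_hy] : y \in G /\ closed_nbrs G h = closed_nbrs G y.
  by move: yT; rewrite inE => /andP[-> /eqP].
have T_sub_y t : t \in twin_class G h -> t \in <[y]>.
  move=> tT; have le_ty := max_y t tT; move: tT; rewrite inE.
  case/andP=> tG /eqP; rewrite eq_hy => eq_yt.
  have : cycle_comp y t by rewrite (eq_closed_nbrs_comp eq_yt) ?cycle_comp_refl.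
  case/orP=> // yt; have := yt; rewrite -cycle_subG => sub_yt.
  by have /eqP-> : <[y]> == <[t]>; rewrite ?cycle_id // eqEcard sub_yt.
have : cycle_comp y k.
  by rewrite -(eq_closed_nbrs_comp eq_hy) // /cycle_comp sub_hk.
have [ky _ | nky] := boolP (k \in <[y]>).
  suff eq_hk : closed_nbrs G h = closed_nbrs G k by rewrite /twin_class eq_hk.
  have [yh | nyh] := boolP (y \in <[h]>).
    apply: eq_cycle_closed_nbrs; apply/eqP.
    by rewrite eqEsubset !cycle_subG sub_hk (mem_cycle_trans ky yh).
  (* With [c := y], the group [<[y]>] is itself a [q]-group, so any [u] in it is comparable to
     [k]. *)
  have [q _ qy] :=
    twins_above_p_elt ncycG hG yG eq_hy (T_sub_y h hT) nyh (cycle_id y).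
  apply/setP=> u; rewrite !inE; case uG: (u \in G) => //=.
  have comp_u := eq_closed_nbrs_comp eq_hy uG.
  apply/idP/idP=> [|/orP[ku | uk]].
  - rewrite comp_u => /orP[yu | uy]; last exact: p_elt_cycle_comp qy ky uy.
    by rewrite /cycle_comp (mem_cycle_trans ky yu).
  - by rewrite /cycle_comp (mem_cycle_trans sub_hk ku).
  - by rewrite comp_u /cycle_comp (mem_cycle_trans uk ky) orbT.
rewrite /cycle_comp (negPf nky) orbF => yk.
(* All generators of [<[k]>] are twins of [k], so it suffices to bound the class of [h] by their
   number. *)
apply: leq_trans (leq_totient_twin_class kG).
have [/forall_inP gen_T | ] :=
  boolP [forall t in twin_class G h, y \in <[t]>].
  apply: (@leq_trans (totient #[y])).
    rewrite totient_gen; apply/subset_leq_card/subsetP=> t tT.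
    by rewrite inE /generator eqEsubset !cycle_subG gen_T // T_sub_y.
  by apply: leq_totient_dvd; rewrite ?order_gt0 // order_dvdG.
rewrite negb_forall_in => /exists_inP[t tT nyt].
have [tG eq_ty] : t \in G /\ closed_nbrs G t = closed_nbrs G y.
  by move: tT; rewrite inE => /andP[-> /eqP <-].
have [q q_pr qk] :=
  twins_above_p_elt ncycG tG kG eq_ty (T_sub_y t tT) nyt yk.
have lt_yk : #[y] < #[k].
  apply: proper_card; rewrite properE !cycle_subG yk; exact: nky.
(* Here the crude bound by the whole of [<[y]>] is enough. *)
apply: (@leq_trans #[y]).
  by apply/subset_leq_card/subsetP=> u /T_sub_y.
move: lt_yk (p_natP (mem_p_elt qk yk)) (p_natP qk) => + [i yi] [j kj].
rewrite yi kj ltn_exp2l ?prime_gt1 // => lt_ij.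
exact: leq_expn_totient.
Qed.
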